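(* Let $k\geq 3$. Then the critical exponent of $W^{(k)}$ is $E(W^{(k)})=3-\frac{3}{2^k-1}$. Moreover, the set of all critical factors of $W^{(k)}$ is $\{P^{(k)}_{3k-1}\oplus ki : i\geq 1\}$, where $P^{(k)}_{3k-1}=W^{(k)}_{k}\,W^{(k)}_{k}\,W^{(k)}_{k-1}W^{(k)}_{k-2}\cdots W^{(k)}_{2}$.
   Context: Fix an integer $k\geq 3$. Words are over the infinite alphabet $\mathbb{N}$ (letters are called digits). Define the morphism $\varphi_k$ on $\mathbb{N}$ by $\varphi_k(ki+j)=(ki)(ki+j+1)$ if $0\le j\le k-2$, and $\varphi_k(ki+j)=(ki+j+1)$ if $j=k-1$ (here $i\ge 0$). The finite $k$-bonacci word is $W^{(k)}_n=\varphi_k^n(0)$ for $n\geq 0$, and the infinite $k$-bonacci word $W^{(k)}$ is the fixed point $\varphi_k^{\omega}(0)$ (each $W^{(k)}_n$ is a prefix of $W^{(k)}$). Concatenation of words $U_n,\dots,U_1$ in this order is written $U_nU_{n-1}\cdots U_1$. For a word $U$ and integer $m$, $m\oplus U$ is the word obtained by adding $m$ to every digit of $U$. For a finite nonempty word $U$ and rational $r$ with $r|U|\in\mathbb{N}$, $U^r$ is the prefix of length $r|U|$ of $UUU\cdots$. For a nonempty factor $U$ of a word $W$, $\mathrm{INDEX}(U,W)=\max\{r\in\mathbb{Q}: U^r \text{ is a factor of } W\}$; the critical exponent is $E(W)=\sup\{\mathrm{INDEX}(U,W): U \text{ a nonempty factor of } W\}$; a factor $U$ is called a critical factor of $W$ if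 $E(W)=\mathrm{INDEX}(U,W)$.
   Formalization: As worded, the words P_{3k-1}⊕ki are not critical factors (a critical factor has length 2^k-1, while P has length 3(2^k-1)-3); the formal theorem says instead that they are exactly the critical repetitions U^{E(W)} with U a critical factor. *)

(* Defs.v *)
From mathcomp Require Import all_boot all_order all_algebra.
From mathcomp Require Import classical_sets.

Set Implicit Arguments.
Unset Strict Implicit.
Unset Printing Implicit Defensive.

Import Order.TTheory GRing.Theory Num.Theory.

Local Open Scope nat_scope.
Local Open Scope classical_set_scope.

(* Digits are natural numbers; finite words are [seq nat], infinite words are
   functions [nat -> nat]. *)

(* With d = k i + j and j < k, [d - d %% k] is k i. *)
Definition phi_digit (k d : nat) : seq nat :=
  if d %% k <= k - 2 then [:: d - d %% k; d.+1] else [:: d.+1].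

Definition phi (k : nat) (U : seq nat) : seq nat :=
  flatten (map (phi_digit k) U).

Definition fin_kbonacci (k n : nat) : seq nat := iter n (phi k) [:: 0].

(* For k >= 2, [fin_kbonacci k n] is a prefix of [fin_kbonacci k n.+1] and has
   more than n digits, so that its n-th digit is that of the limit word;
   see [kbonacciE] and [kbonacci_fixpoint] below. *)
Definition kbonacci (k : nat) : nat -> nat :=
  fun n => nth 0 (fin_kbonacci k n) n.

Definition shift_word (m : nat) (U : seq nat) : seq nat := map (addn m) U.

(* Indices run downwards: fin_kbonacci k k.-1, ..., fin_kbonacci k 2. *)
Definition P_word (k : nat) : seq nat :=
  fin_kbonacci k k ++ fin_kbonacci k k ++
  flatten [seq fin_kbonacci k n | n <- rev (iota 2 (k - 2))].

Definition factor (W : nat -> nat) (V : seq nat) : Prop :=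
  exists p, V = mkseq (fun j => W (p + j)) (size V).

(* [is_power U r V]: r |U| is a natural number and V = U^r, the prefix of
   length r |U| of U U U ... *)
Definition is_power (U : seq nat) (r : rat) (V : seq nat) : Prop :=
  ((size V)%:R = r * (size U)%:R)%R /\
  V = mkseq (fun j => nth 0 U (j %% size U)) (size V).

Definition exponents (W : nat -> nat) (U : seq nat) : set rat :=
  [set r | exists2 V, is_power U r V & factor W V].

(* [is_index W U r]: INDEX(U, W) exists and equals r. *)
Definition is_index (W : nat -> nat) (U : seq nat) (r : rat) : Prop :=
  exponents W U r /\ ubound (exponents W U) r.

Definition nonempty_factors (W : nat -> nat) : set (seq nat) :=
  [set U | U != [::] /\ factor W U].

(* [is_critical_exponent W e]: E(W) is well defined and equals e.  The first
   clause asserts that every index exists, so that no factor is left out of the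
   supremum. *)
Definition is_critical_exponent (W : nat -> nat) (e : rat) : Prop :=
  (forall U, nonempty_factors W U -> exists r, is_index W U r) /\
  isLub [set r | exists2 U, nonempty_factors W U & is_index W U r] e.

Definition critical_factor (W : nat -> nat) (U : seq nat) : Prop :=
  nonempty_factors W U /\
  exists2 e, is_critical_exponent W e & is_index W U e.

(* The repetitions U^E(W) with U a critical factor of W; such a word is
   determined by, and determines, the critical factor U. *)
Definition critical_powers (W : nat -> nat) : set (seq nat) :=
  [set V | exists U e, [/\ critical_factor W U, is_critical_exponent W e
                         & is_power U e V]].

Lemma phi_cat k U V : phi k (U ++ V) = phi k U ++ phi k V.
Proof. by rewrite /phi map_cat flatten_cat. Qed.

Lemma size_phi_ge k U : size U <= size (phi k U).
Proof.
elim: U => //= d U IH; rewrite -cat1s phi_cat size_cat -add1n leq_add //.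
by rewrite /phi /= cats0 /phi_digit; case: ifP.
Qed.

Lemma fin_kbonacciS k n : 1 < k ->
  exists2 V, V != [::] & fin_kbonacci k n.+1 = fin_kbonacci k n ++ V.
Proof.
move=> k1; elim: n => [|n [V V0 E]].
  by exists [:: 1] => //; rewrite /fin_kbonacci /= /phi /= /phi_digit mod0n.
exists (phi k V); last by rewrite {1}/fin_kbonacci iterS -/(fin_kbonacci k n.+1)
  {1}E phi_cat.
by rewrite -size_eq0 -lt0n (leq_trans _ (size_phi_ge k V)) // lt0n size_eq0.
Qed.

Lemma size_fin_kbonacci k n : 1 < k -> n < size (fin_kbonacci k n).
Proof.
move=> k1; elim: n => // n IH; have [V V0 ->] := fin_kbonacciS n k1.
by rewrite size_cat -[n.+2]addn1 leq_add // lt0n size_eq0.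
Qed.

Lemma fin_kbonacci_prefix k m n : 1 < k -> m <= n ->
  exists V, fin_kbonacci k n = fin_kbonacci k m ++ V.
Proof.
move=> k1 /subnKC <-; elim: (n - m) => [|d [V E]].
  by exists [::]; rewrite addn0 cats0.
have [V' _ E'] := fin_kbonacciS (m + d) k1.
by exists (V ++ V'); rewrite addnS E' E catA.
Qed.

Lemma kbonacciE k n j : 1 < k -> j < size (fin_kbonacci k n) ->
  kbonacci k j = nth 0 (fin_kbonacci k n) j.
Proof.
move=> k1 lt_j; rewrite /kbonacci; case: (leqP j n) => [le_jn | /ltnW le_nj].
  have [V ->] := fin_kbonacci_prefix k1 le_jn.
  by rewrite nth_cat size_fin_kbonacci.
by have [V ->] := fin_kbonacci_prefix k1 le_nj; rewrite nth_cat lt_j.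
Qed.

Lemma kbonacci_fixpoint k n j : 1 < k -> j < size (phi k (mkseq (kbonacci k) n)) ->
  nth 0 (phi k (mkseq (kbonacci k) n)) j = kbonacci k j.
Proof.
move=> k1; have En : mkseq (kbonacci k) n = take n (fin_kbonacci k n).
  have sn := size_fin_kbonacci n k1.
  apply: (@eq_from_nth _ 0); rewrite size_mkseq ?size_take ?sn // => i lt_in.
  by rewrite nth_mkseq // nth_take // (@kbonacciE k n) // (ltn_trans lt_in).
rewrite En => lt_j; have E : fin_kbonacci k n.+1 =
    phi k (take n (fin_kbonacci k n)) ++ phi k (drop n (fin_kbonacci k n)).
  by rewrite -phi_cat cat_take_drop.
by rewrite (@kbonacciE k n.+1) // E ?nth_cat ?lt_j // size_cat ltn_addr.
Qed.

(* Main.v *)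
Require Import Defs.
From mathcomp Require Import all_boot all_order all_algebra.
From mathcomp Require Import boolp classical_sets.
From mathcomp Require Import zify ring.

Import Order.TTheory GRing.Theory Num.Theory.

(* Every block [phi_digit k d] starts with a multiple of k and contains no other
   one, so two equal factors of W can be desubstituted simultaneously.  Hence a
   repetition of period p comes, by applying phi n times, from two positions
   s' < t' carrying distinct digits, and the length by which it exceeds p is the
   length of the longest common prefix of the suffixes of W starting at the
   n-fold images of s' and t'.  Applying phi once to the distinct digits prolongs
   this prefix exactly when both blocks start with the same multiple of k.
   Following these pairs of digits, the prefix is at most p long, unless
   t' = s' + 1 and the digits at s' and t' are ki + k-1 and k(i+1); then p = w(m)
   with m = n - 1 and w(m) = |W_m|, and the prefix has length
   w(m) + w(m-1) + ... + w(m-k+2).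
   The ratio of this length to w(m) is maximal only for m = k, where it equals
   2 - 3 / (2^k - 1). *)

Local Open Scope nat_scope.

(** * Iterated images of words and single digits, and their lengths *)

Lemma iter_phi_cat k n U V :
  iter n (phi k) (U ++ V) = iter n (phi k) U ++ iter n (phi k) V.
Proof. by elim: n => //= n ->; rewrite phi_cat. Qed.

Lemma phi_small k i j : j < k.-1 ->
  phi k [:: k * i + j] = [:: k * i; k * i + j.+1].
Proof.
move=> hj; rewrite /phi /= cats0 /phi_digit mulnC modnMDl modn_small; last lia.
by rewrite (_ : j <= k - 2); [rewrite addnK addnS | lia].
Qed.

Lemma phi_large k i : 1 < k -> phi k [:: k * i + k.-1] = [:: k * i.+1].
Proof.
move=> hk; rewrite /phi /= cats0 /phi_digit mulnC modnMDl modn_small; last lia.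
by rewrite (_ : k.-1 <= k - 2 = false); [congr [:: _]|]; lia.
Qed.

(** The branch taken by [phi_digit] depends only on the residue modulo [k], and both branches move
    along with the digit. Images and lengths thus reduce to digits below [k]. *)
Lemma phi_shift k i U :
  phi k (shift_word (k * i) U) = shift_word (k * i) (phi k U).
Proof.
rewrite /phi /shift_word; elim: U => //= d U IH; rewrite map_cat IH.
congr (_ ++ _).
rewrite /phi_digit mulnC modnMDl; case: ifP => _ /=; rewrite addnS //.
by rewrite addnBA // leq_mod.
Qed.

Lemma iter_phi_shift k n i U :
  iter n (phi k) (shift_word (k * i) U) = shift_word (k * i) (iter n (phi k) U).
Proof. by elim: n => //= n ->; rewrite phi_shift. Qed.

Lemma iter_phi_multiple k n i :
  iter n (phi k) [:: k * i] = shift_word (k * i) (fin_kbonacci k n).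
Proof. by rewrite -iter_phi_shift /shift_word /= addn0. Qed.

Definition image_length k n d := size (iter n (phi k) [:: d]).

Lemma image_length_shift k n i j :
  image_length k n (k * i + j) = image_length k n j.
Proof.
by rewrite /image_length -[[:: _]]/(shift_word (k * i) [:: j]) iter_phi_shift
  size_map.
Qed.

Lemma image_length_multiple k n i :
  image_length k n (k * i) = size (fin_kbonacci k n).
Proof. by rewrite /image_length iter_phi_multiple size_map. Qed.

Lemma image_lengthS k n j : j < k.-1 ->
  image_length k n.+1 j = size (fin_kbonacci k n) + image_length k n j.+1.
Proof.
move=> hj; rewrite /image_length iterSr -[j]/(0 + j) -(muln0 k) phi_small //.
by rewrite -cat1s iter_phi_cat size_cat muln0.
Qed.

Lemma image_lengthS_large k n : 1 < k ->
  image_length k n.+1 k.-1 = size (fin_kbonacci k n).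
Proof.
move=> hk; rewrite -(image_length_multiple k n 1) /image_length iterSr.
by rewrite -[k.-1]/(0 + k.-1) -(muln0 k) phi_large // muln0.
Qed.

Lemma image_length_gt0 k n d : 0 < image_length k n d.
Proof.
rewrite /image_length; elim: n => //= n IH.
exact: leq_trans IH (size_phi_ge _ _).
Qed.

(** * Positions at which images of digits start in the infinite word *)

Definition image_pos k n x := size (iter n (phi k) (mkseq (kbonacci k) x)).

(** Images of prefixes of the fixed point are prefixes again, so [image_pos k n x] is where the
    [n]-fold image of the digit at [x] starts. *)
Lemma mkseq_image_pos k n x : 1 < k ->
  mkseq (kbonacci k) (image_pos k n x) = iter n (phi k) (mkseq (kbonacci k) x).
Proof.
move=> hk; rewrite /image_pos; elim: n => [|n IH]; first by rewrite size_mkseq.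
rewrite iterS -IH; apply: (@eq_from_nth _ 0); rewrite size_mkseq // => i hi.
by rewrite nth_mkseq // kbonacci_fixpoint.
Qed.

Lemma image_pos_comp k m n x : 1 < k ->
  image_pos k m (image_pos k n x) = image_pos k (m + n) x.
Proof. by move=> hk; rewrite {1}/image_pos mkseq_image_pos // -iterD. Qed.

Lemma image_pos0 k x : image_pos k 0 x = x.
Proof. exact: size_mkseq. Qed.

Lemma image_posS k n x :
  image_pos k n x.+1 = image_pos k n x + image_length k n (kbonacci k x).
Proof. by rewrite /image_pos mkseqS -cats1 iter_phi_cat size_cat. Qed.

Lemma kbonacci_image_pos k n x j : 1 < k -> j < image_length k n (kbonacci k x) ->
  kbonacci k (image_pos k n x + j) =
  nth 0 (iter n (phi k) [:: kbonacci k x]) j.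
Proof.
move=> hk hj; have hs : image_pos k n x + j < image_pos k n x.+1.
  by rewrite image_posS ltn_add2l.
rewrite -(@nth_mkseq _ 0 (kbonacci k) _ _ hs) mkseq_image_pos // mkseqS -cats1.
by rewrite iter_phi_cat nth_cat -/(image_pos k n x) ltnNge leq_addr /= addKn.
Qed.

Lemma leq_image_pos k n x y : x <= y -> image_pos k n x <= image_pos k n y.
Proof.
by move/subnKC <-; elim: (y - x) => [|d IH]; rewrite ?addn0 ?addnS ?image_posS //;
  lia.
Qed.

(** The first digit [0] has an image of length two, and no image is empty. Strictness makes
    desubstitution terminate. *)
Lemma image_pos1_gt k x : 1 < k -> 0 < x -> x < image_pos k 1 x.
Proof.
move=> hk; elim: x => // -[_ _|x IH _]; last first.
  by rewrite image_posS; have := image_length_gt0 k 1 (kbonacci k x.+1); lia.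
have hk' : 0 < k.-1 by lia.
have := image_length_gt0 k 0 1; rewrite image_posS (image_lengthS k 0 0 hk') /=; lia.
Qed.

(** * Block structure of the fixed point and neighbouring digits *)

Lemma digitP k d : 0 < k -> exists i j, d = k * i + j /\ j < k.
Proof. by move=> hk; exists (d %/ k), (d %% k); rewrite mulnC -divn_eq ltn_mod. Qed.

Lemma digit_inj k i j i' j' : j < k -> j' < k -> k * i + j = k * i' + j' ->
  i = i' /\ j = j'.
Proof.
move=> hj hj' E; have hk : 0 < k by lia.
have := congr1 (divn^~ k) E; have := congr1 (modn^~ k) E.
by rewrite !(mulnC k) !modnMDl !divnMDl // !divn_small // !modn_small // !addn0.
Qed.

Lemma image_pos1_small k x i j : j < k.-1 -> kbonacci k x = k * i + j ->
  [/\ image_pos k 1 x.+1 = (image_pos k 1 x).+2,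
      kbonacci k (image_pos k 1 x) = k * i
    & kbonacci k (image_pos k 1 x).+1 = k * i + j.+1].
Proof.
move=> hj E; have hk : 1 < k by lia.
have F : iter 1 (phi k) [:: kbonacci k x] = [:: k * i; k * i + j.+1].
  by rewrite E /= phi_small.
have L : image_length k 1 (kbonacci k x) = 2 by rewrite /image_length F.
split; first by rewrite image_posS L addn2.
  by rewrite -[image_pos k 1 x]addn0 kbonacci_image_pos ?L // F.
by rewrite -addn1 kbonacci_image_pos ?L // F.
Qed.

Lemma image_pos1_large k x i : 1 < k -> kbonacci k x = k * i + k.-1 ->
  image_pos k 1 x.+1 = (image_pos k 1 x).+1 /\
  kbonacci k (image_pos k 1 x) = k * i.+1.
Proof.
move=> hk E; have F : iter 1 (phi k) [:: kbonacci k x] = [:: k * i.+1].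
  by rewrite E /= phi_large.
have L : image_length k 1 (kbonacci k x) = 1 by rewrite /image_length F.
split; first by rewrite image_posS L addn1.
by rewrite -[image_pos k 1 x]addn0 kbonacci_image_pos ?L // F.
Qed.

(** Uniform in both kinds of block: each opens with the largest multiple of [k] not exceeding the
    successor of the digit mapped. *)
Lemma kbonacci_image_pos1 k x : 1 < k ->
  kbonacci k (image_pos k 1 x) = k * ((kbonacci k x).+1 %/ k).
Proof.
move=> hk; have [i [j [E hj]]] := digitP k (kbonacci k x) (ltnW hk).
have [hj'|hj'] := ltnP j k.-1.
  have [_ -> _] := image_pos1_small k x i j hj' E.
  by rewrite E -addnS mulnC divnMDl ?divn_small; lia.
have Ej : j = k.-1 by lia.
have [_ ->] := image_pos1_large k x i hk (etrans E (congr1 _ Ej)).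
rewrite E Ej -addnS prednK ?[k * i]mulnC ?divnMDl ?divnn; lia.
Qed.

Lemma kbonacci0 k : kbonacci k 0 = 0.
Proof. by []. Qed.

(** The blocks tile the fixed point, so stepping to the next position either stays inside a block of
    length two or opens the next block. *)
Lemma image_pos1_cases k t : 1 < k -> exists x, t = image_pos k 1 x \/
  exists i j, [/\ j < k.-1, kbonacci k x = k * i + j & t = (image_pos k 1 x).+1].
Proof.
move=> hk; elim: t => [|t [x [->|[i [j [hj E ->]]]]]]; first by exists 0; left.
  have [i [j [E hj]]] := digitP k (kbonacci k x) (ltnW hk).
  have [hj'|hj'] := ltnP j k.-1; first by exists x; right; exists i, j.
  have Ej : j = k.-1 by lia.
  have [<- _] := image_pos1_large k x i hk (etrans E (congr1 _ Ej)).
  by exists x.+1; left.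
by have [<- _ _] := image_pos1_small k x i j hj E; exists x.+1; left.
Qed.

(** A nonmultiple of [k] never opens a block, so it is the second digit of a block whose first digit
    is known. *)
Lemma kbonacci_adjacent_nonmultiple k x i j : 1 < k -> 0 < j < k ->
  kbonacci k x.+1 = k * i + j -> kbonacci k x = k * i.
Proof.
move=> hk hj E; have [y [Ey|[i' [j' [hj' Ey Ex]]]]] := image_pos1_cases k x.+1 hk.
  move: E; rewrite Ey kbonacci_image_pos1 // -[k * (_ %/ _)]addn0.
  by case/digit_inj; lia.
have [_ E1 E2] := image_pos1_small k y i' j' hj' Ey.
case: Ex => Ex; rewrite Ex E1; move: E; rewrite Ex E2.
by case/digit_inj; [lia..|move=> ->].
Qed.

(** Strong induction through one desubstitution: the quotient is constant inside a block, and across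
    a boundary the claim pulls back to the two digits that produced the blocks. *)
Lemma kbonacci_adjacent k x : 1 < k ->
  kbonacci k x.+1 %/ k <= (kbonacci k x %/ k).+1.
Proof.
move=> hk; have k0 : 0 < k by lia.
have divE i j : j < k -> (k * i + j) %/ k = i.
  by move=> hj; rewrite mulnC divnMDl ?divn_small ?addn0.
elim/ltn_ind: x => x IH.
have [[|y] [Ey|[i [j [hj Ey Ex]]]]] := image_pos1_cases k x.+1 hk.
- by rewrite /image_pos /= in Ey.
- have [_ E1 E2] := image_pos1_small k 0 i j hj Ey.
  by case: Ex => Ex; rewrite Ex E2 E1 divE ?mulKn //; lia.
- have [i [j [E hj]]] := digitP k (kbonacci k y) k0.
  (* Blocks of either length end in the successor of the digit mapped. *)
  have hW : kbonacci k x = (kbonacci k y).+1 /\ y < x.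
    have [hj'|hj'] := ltnP j k.-1.
      have [E1 _ E2] := image_pos1_small k y i j hj' E.
      move: Ey; rewrite E1 => -[->]; rewrite E2 E addnS; split=> //.
      case: (posnP y) => [->|/(image_pos1_gt k y hk)]; lia.
    have Ej : j = k.-1 by lia.
    have [E1 E2] := image_pos1_large k y i hk (etrans E (congr1 _ Ej)).
    move: Ey; rewrite E1 => -[->]; rewrite E2 E; split; first lia.
    by apply: image_pos1_gt => //; case: y E {IH E1 E2} => //; rewrite kbonacci0; lia.
  have [-> /IH {}IH] := hW; rewrite Ey kbonacci_image_pos1 // mulKn //.
  have [i' [j' [E' hj']]] := digitP k (kbonacci k y.+1) k0.
  have [jm|jm] := ltnP j' k.-1.
    rewrite E' -addnS divE; last lia.
    by move: IH; rewrite E' divE // => /leq_trans-> //; rewrite ltnS leq_div2r.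
  have Ej : j' = k.-1 by lia.
  (* Here the successor crosses a multiple of [k] and the induction hypothesis may fall short by
     one; the digit at [y] is determined instead. *)
  have E0 : kbonacci k y = k * i'.
    by apply: (@kbonacci_adjacent_nonmultiple _ _ _ j') => //; lia.
  rewrite E' E0 Ej (_ : (k * i' + k.-1).+1 = k * i'.+1); last lia.
  by rewrite mulKn // ltnS -(addn1 (k * i')) divE.
- have [_ E1 E2] := image_pos1_small k y.+1 i j hj Ey.
  by case: Ex => Ex; rewrite Ex E2 E1 divE ?mulKn //; lia.
Qed.

Lemma kbonacci_after_block_end k x i : 2 < k ->
  kbonacci k x = k * i + k.-1 ->
  exists2 m, kbonacci k x.+1 = k * m & m <= i.+1.
Proof.
move=> hk E; have k1 : 1 < k by lia.
have [m [[|j] [E' hj]]] := digitP k (kbonacci k x.+1) (ltnW k1); last first.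
  have := kbonacci_adjacent_nonmultiple k x m j.+1 k1 hj E'.
  by rewrite E -(addn0 (k * m)) => /digit_inj; lia.
exists m; first by rewrite E' addn0.
have := kbonacci_adjacent k x k1.
by rewrite E E' addn0 mulKn ?[k * i]mulnC ?divnMDl ?divn_small ?addn0; lia.
Qed.

(** * Common prefixes of suffixes, and desubstitution *)

Definition agree k s t l :=
  forall i, i < l -> kbonacci k (s + i) = kbonacci k (t + i).

Definition agree_exactly k s t l :=
  agree k s t l /\ kbonacci k (s + l) <> kbonacci k (t + l).

Lemma agree_exactly_sym k s t l : agree_exactly k s t l -> agree_exactly k t s l.
Proof. by case=> h1 h2; split=> [i /h1 ->|/esym]. Qed.

Lemma agree_exactly_max k s t l m :
  agree_exactly k s t l -> agree k s t m -> m <= l.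
Proof. by case=> _ ne /(_ l) h; rewrite leqNgt; apply/negP=> /h. Qed.

Lemma agree_cat k s t l m :
  agree k s t l -> agree k (s + l) (t + l) m -> agree k s t (l + m).
Proof.
move=> h1 h2 i hi; have [/h1//|hl] := ltnP i l.
have -> : i = l + (i - l) by lia.
by rewrite !addnA h2 //; lia.
Qed.

Lemma agree_exactly_cat k s t l m :
  agree k s t l -> agree_exactly k (s + l) (t + l) m ->
  agree_exactly k s t (l + m).
Proof. by move=> h1 [h2 h3]; split; rewrite ?addnA //; apply: agree_cat. Qed.

Lemma agree_image_letter k n s t : 1 < k -> kbonacci k s = kbonacci k t ->
  agree k (image_pos k n s) (image_pos k n t) (image_length k n (kbonacci k s)).
Proof. by move=> hk E i hi; rewrite !kbonacci_image_pos ?E // -E. Qed.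

Lemma agree_image k n s t l : 1 < k -> agree k s t l -> exists m,
  [/\ image_pos k n (s + l) = image_pos k n s + m,
      image_pos k n (t + l) = image_pos k n t + m
    & agree k (image_pos k n s) (image_pos k n t) m].
Proof.
move=> hk; elim: l => [_|l IH h]; first by exists 0; rewrite !addn0; split.
have [|m [E1 E2 h2]] := IH; first by move=> i hi; apply: h; lia.
exists (m + image_length k n (kbonacci k (s + l))).
split; first by rewrite addnS image_posS E1 addnA.
  by rewrite addnS image_posS E2 -h // addnA.
by apply: agree_cat => //; rewrite -E1 -E2; apply: agree_image_letter; auto.
Qed.

Lemma agree_exactly_image_cons k n s t d : 1 < k ->
  kbonacci k s = kbonacci k t ->
  agree_exactly k (image_pos k n s.+1) (image_pos k n t.+1) d ->
  agree_exactly k (image_pos k n s) (image_pos k n t)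
    (image_length k n (kbonacci k s) + d).
Proof.
move=> hk E; rewrite !image_posS -E => h; apply: agree_exactly_cat h.
exact: agree_image_letter.
Qed.

(* Repeated desubstitution: a block starts exactly at each multiple of [k], so
   two equal digits lie at the same offset in their blocks. *)
Lemma desubstitute k s t : 1 < k -> s < t -> exists n s' t' d,
  [/\ s' < t', kbonacci k s' <> kbonacci k t',
      s = image_pos k n s' + d, t = image_pos k n t' + d
    & agree k (image_pos k n s') (image_pos k n t') d].
Proof.
move=> hk; elim/ltn_ind: t s => t IH s st.
have [E|ne] := eqVneq (kbonacci k s) (kbonacci k t); last first.
  by exists 0, s, t, 0; rewrite !image_pos0 !addn0; split=> //; apply/eqP.
(* One step back: [e] is the common offset, [0] or [1], of [s] and [t] in their blocks. The mixed
   cases would equate a multiple of [k] with a nonmultiple. *)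
have [s1 [t1 [e [Es Et he]]]] : exists s1 t1 e,
    [/\ s = image_pos k 1 s1 + e, t = image_pos k 1 t1 + e
      & agree k (image_pos k 1 s1) (image_pos k 1 t1) e].
  have [s1 [Es|[i [j [hj Es Es']]]]] := image_pos1_cases k s hk;
  have [t1 [Et|[i' [j' [hj' Et Et']]]]] := image_pos1_cases k t hk.
  - by exists s1, t1, 0; rewrite !addn0; split.
  - have [_ _] := image_pos1_small k t1 i' j' hj' Et.
    rewrite -Et' -E Es kbonacci_image_pos1 // -[k * (_ %/ _)]addn0.
    by case/digit_inj; lia.
  - have [_ _] := image_pos1_small k s1 i j hj Es.
    rewrite -Es' E Et kbonacci_image_pos1 // -[k * (_ %/ _)]addn0.
    by case/digit_inj; lia.
  have [_ A1] := image_pos1_small k s1 i j hj Es; rewrite -Es' => A2.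
  have [_ B1] := image_pos1_small k t1 i' j' hj' Et; rewrite -Et' => B2.
  have [Ei [Ej]] : i = i' /\ j.+1 = j'.+1.
    by apply: (@digit_inj k); rewrite -?A2 -?B2 //; lia.
  exists s1, t1, 1; rewrite !addn1 -Es' -Et'; split=> //.
  by case=> // _; rewrite !addn0 A1 B1 Ei.
have st1 : s1 < t1.
  rewrite ltnNge; apply/negP => /(leq_image_pos k 1); lia.
(* [t1] is positive because [s1 < t1], so its image position exceeds it. *)
have t1t : t1 < t by have := image_pos1_gt k t1 hk; lia.
have [n [s' [t' [d [st' ne Es1 Et1 hd]]]]] := IH t1 t1t s1 st1.
have [m [F1 F2 hm]] := agree_image k 1 _ _ _ hk hd.
exists n.+1, s', t', (m + e).
move: F1 F2 hm; rewrite -Es1 -Et1 !image_pos_comp // add1n => F1 F2 hm.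
split=> //; rewrite ?addnA -?F1 -?F2 //.
by apply: agree_cat; rewrite // -F1 -F2.
Qed.

(** * Longest common prefixes of the images of two distinct digits *)

Lemma succ_div k i j : j < k.-1 -> (k * i + j).+1 %/ k = i.
Proof. by move=> hj; rewrite -addnS mulnC divnMDl ?divn_small ?addn0; lia. Qed.

Lemma succ_div_large k i : 0 < k -> (k * i + k.-1).+1 %/ k = i.+1.
Proof. by move=> hk; rewrite -addnS prednK // -mulnSr mulKn. Qed.

(** After one application the first digit is stable, as the image of a multiple of [k] starts with
    that multiple. *)
Lemma kbonacci_image_posS k n x : 1 < k ->
  kbonacci k (image_pos k n.+1 x) = k * ((kbonacci k x).+1 %/ k).
Proof.
move=> hk; elim: n => [|n IH]; first exact: kbonacci_image_pos1.
rewrite -(addn1 n.+1) addnC -image_pos_comp // kbonacci_image_pos1 // IH.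
by congr (k * _); rewrite -[k * _]addn0 succ_div //; lia.
Qed.

Lemma agree_exactly0 k n s t : 1 < k ->
  (kbonacci k s).+1 %/ k != (kbonacci k t).+1 %/ k ->
  agree_exactly k (image_pos k n s) (image_pos k n t) 0.
Proof.
move=> hk ne; split=> //; rewrite !addn0; case: n => [|n].
  by rewrite !image_pos0 => E; rewrite E eqxx in ne.
rewrite !kbonacci_image_posS // => /eqP; rewrite eqn_pmul2l ?(negPf ne) //.
by lia.
Qed.

(** With [w(m)] the length of [fin_kbonacci k m], this is [w(n-1) + ... + w(n-c)], cut off after
    [w(0)]. *)
Fixpoint length_sum k n c :=
  if n isn't n'.+1 then 0 else
  if c isn't c'.+1 then 0 else size (fin_kbonacci k n') + length_sum k n' c'.

Lemma leq_length_sum k n c c' : c <= c' -> length_sum k n c <= length_sum k n c'.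
Proof. by elim: n c c' => // n IH [|c] [|c'] //= h; rewrite leq_add2l IH. Qed.

Lemma length_sum_leq k n j : 1 < k -> j < k ->
  length_sum k n (k.-1 - j) <= image_length k n j.
Proof.
move=> hk; elim: n j => [|n IH] j hj; first by [].
have [hj'|hj'] := ltnP j k.-1; last by rewrite (_ : k.-1 - j = 0) //; lia.
rewrite image_lengthS // (_ : k.-1 - j = (k.-1 - j.+1).+1) /=; last lia.
by rewrite leq_add2l IH //; lia.
Qed.

Lemma length_sum_leq_multiple k n i c : 1 < k -> c < k ->
  length_sum k n c <= image_length k n (k * i).
Proof.
move=> hk hc; rewrite -(addn0 (k * i)) image_length_shift.
apply: leq_trans (length_sum_leq k n 0 hk _); last lia.
by rewrite leq_length_sum; lia.
Qed.

(** Both blocks start with [k * i], whose further image is common, and continue with the residues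
    [j + 1] and [j' + 1]. This repeats until no application is left or the larger residue is
    [k - 1], whose block starts with the next multiple of [k]. *)
Lemma agree_exactly_same_block k n s t i j j' : j < j' < k ->
  kbonacci k s = k * i + j -> kbonacci k t = k * i + j' ->
  agree_exactly k (image_pos k n s) (image_pos k n t) (length_sum k n (k.-1 - j')).
Proof.
elim: n s t j j' => [|n IH] s t j j' hj Es Et.
  by rewrite !image_pos0; split=> //; rewrite !addn0 Es Et; lia.
have hk : 1 < k by lia.
have [hj'|hj'] := ltnP j' k.-1; last first.
  rewrite (_ : k.-1 - j' = 0); last lia.
  apply: agree_exactly0 => //; rewrite Es Et succ_div; last lia.
  by rewrite (_ : j' = k.-1) ?succ_div_large; lia.
have [hj1 hj2] : j < k.-1 /\ j'.+1 < k by lia.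
have [_ A1 A2] := image_pos1_small k s i j hj1 Es.
have [_ B1 B2] := image_pos1_small k t i j' hj' Et.
have -> : length_sum k n.+1 (k.-1 - j') =
    image_length k n (k * i) + length_sum k n (k.-1 - j'.+1).
  by rewrite (_ : k.-1 - j' = (k.-1 - j'.+1).+1) /= ?image_length_multiple; lia.
rewrite -(addn1 n) -!image_pos_comp // -A1.
apply: agree_exactly_image_cons; rewrite ?A1 //.
by apply: IH A2 B2; lia.
Qed.

(** Both blocks start with [k * i.+1]. Then [k * i.+1 + j.+1] faces the first digit [k * m] of the
    block after that of [s]: for [m = i.+1] the same-block case continues, otherwise the images
    differ at once. *)
Lemma agree_exactly_next_block k n s t i j : 2 < k -> j < k.-1 ->
  kbonacci k s = k * i + k.-1 -> kbonacci k t = k * i.+1 + j ->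
  exists d, [/\ agree_exactly k (image_pos k n s) (image_pos k n t) d,
    d <= length_sum k n (k.-1 - j)
  & kbonacci k s.+1 = k * i.+1 -> d = length_sum k n (k.-1 - j)].
Proof.
move=> hk hj Es Et; have k1 : 1 < k by lia.
case: n => [|n].
  exists 0; split=> //; rewrite !image_pos0; split=> //; rewrite !addn0 Es Et.
  by move/digit_inj; lia.
have [m Em hm] := kbonacci_after_block_end k s i hk Es.
have [A0 A1] := image_pos1_large k s i k1 Es.
have [_ B1 B2] := image_pos1_small k t i.+1 j hj Et.
have A2 : kbonacci k (image_pos k 1 s).+1 = k * m.
  rewrite -A0 kbonacci_image_pos1 // Em -(addn0 (k * m)) succ_div ?addn0 //; lia.
have [d [hd hdle hdE]] : exists d,
    [/\ agree_exactly k (image_pos k n (image_pos k 1 s).+1)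
                        (image_pos k n (image_pos k 1 t).+1) d,
        d <= length_sum k n (k.-1 - j.+1)
      & m = i.+1 -> d = length_sum k n (k.-1 - j.+1)].
  have [Emi|nmi] := eqVneq m i.+1.
    exists (length_sum k n (k.-1 - j.+1)); split=> //.
    by apply: (@agree_exactly_same_block _ _ _ _ i.+1 0) B2; lia.
  exists 0; split=> //; last by move/eqP; rewrite (negPf nmi).
  apply: agree_exactly0 => //.
  rewrite A2 B2 -(addn0 (k * m)) succ_div; last lia.
  have [hj'|hj'] := ltnP j.+1 k.-1; first by rewrite succ_div.
  by rewrite (_ : j.+1 = k.-1) ?succ_div_large; lia.
exists (size (fin_kbonacci k n) + d).
rewrite (_ : k.-1 - j = (k.-1 - j.+1).+1) /=; last lia.
split; last 2 first.
- by rewrite leq_add2l.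
- move=> E; rewrite hdE //; move: E; rewrite Em => /eqP.
  by rewrite eqn_pmul2l ?(ltnW k1) // => /eqP.
rewrite -(addn1 n) -!image_pos_comp // -(image_length_multiple k n i.+1) -A1.
by apply: agree_exactly_image_cons; rewrite // A1 B1.
Qed.

(* The last alternative is the only way to get exponents larger than 2. *)
Lemma agree_exactly_image_pos k n s t : 2 < k -> s < t ->
  kbonacci k s <> kbonacci k t -> exists d,
  agree_exactly k (image_pos k n s) (image_pos k n t) d /\
  (image_pos k n s + d <= image_pos k n t \/
   exists i, [/\ t = s.+1, kbonacci k s = k * i + k.-1, kbonacci k t = k * i.+1
     & d = length_sum k n k.-1]).
Proof.
move=> hk st ne; have k1 : 1 < k by lia.
have lt1 : image_pos k n s + image_length k n (kbonacci k s) <= image_pos k n t.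
  by rewrite -image_posS leq_image_pos.
have [i [j [Es hj]]] := digitP k (kbonacci k s) (ltnW k1).
have [i' [j' [Et hj']]] := digitP k (kbonacci k t) (ltnW k1).
(* The image of the digit at [s] ends no later than that of [t] starts, so a common prefix that fits
   into it gives the first alternative. *)
have lt2 d c : d <= length_sum k n c -> c <= k.-1 - j ->
    image_pos k n s + d <= image_pos k n t.
  move=> hd hc; apply: leq_trans lt1; rewrite leq_add2l Es image_length_shift.
  apply: leq_trans hd (leq_trans (leq_length_sum k n _ _ hc) _).
  exact: length_sum_leq.
have [E|nE] := eqVneq ((kbonacci k s).+1 %/ k) ((kbonacci k t).+1 %/ k); last first.
  by exists 0; split; [apply: agree_exactly0 | left; lia].
have [hj1|hj1] := ltnP j k.-1; have [hj1'|hj1'] := ltnP j' k.-1.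
- move: E; rewrite Es Et !succ_div // => Ei; rewrite -{}Ei in Et.
  have [jj|jj|jj] := ltngtP j j'; last by case: ne; rewrite Es Et jj.
    exists (length_sum k n (k.-1 - j')); split.
      by apply: agree_exactly_same_block Es Et; rewrite jj.
    by left; apply: lt2 (leqnn _) _; lia.
  exists (length_sum k n (k.-1 - j)); split; last by left; apply: lt2 (leqnn _) _.
  by apply: agree_exactly_sym; apply: agree_exactly_same_block Et Es; rewrite jj.
- have Ej : j' = k.-1 by lia.
  move: E; rewrite Es Et Ej succ_div // succ_div_large; last lia.
  move=> Ei; rewrite Ei in Es; rewrite Ej in Et.
  have [d [/agree_exactly_sym hd hdle _]] :=
    agree_exactly_next_block k n t s i' j hk hj1 Et Es.
  by exists d; split=> //; left; apply: lt2 hdle _.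
- have Ej : j = k.-1 by lia.
  have Ei : i.+1 = i'.
    by move: E; rewrite Es Et Ej succ_div_large ?succ_div //; lia.
  rewrite -Ei in Et; rewrite Ej in Es.
  have [d [hd hdle hdE]] := agree_exactly_next_block k n s t i j' hk hj1' Es Et.
  exists d; split=> //; have [m Em _] := kbonacci_after_block_end k s i hk Es.
  have [Est|nst] := eqVneq t s.+1.
    right; exists i; rewrite -Est in Em hdE.
    have j0 : j' = 0.
      by move: Em; rewrite Et -[in X in _ = X](addn0 (k * m)) => /digit_inj[]; lia.
    move: Et hdE; rewrite j0 addn0 subn0 => Et hdE; split=> //. exact: hdE.
  (* The digit after [s] is a multiple of [k] lying before [t], and its image alone is at least [d]
     long. *)
  left; have st' : s.+2 <= t by lia.
  apply: leq_trans (leq_image_pos k n _ _ st').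
  rewrite !image_posS Em -addnA leq_add2l.
  apply: leq_trans hdle (leq_trans _ (leq_addl _ _)).
  by apply: length_sum_leq_multiple => //; lia.
- case: ne; have Ej : j = k.-1 by lia.
  have Ej' : j' = k.-1 by lia.
  by move: E; rewrite Es Et Ej Ej' !succ_div_large ?(ltnW k1) // => -[->].
Qed.

(** * Lengths of the finite words and the extremal ratio *)

Lemma image_length_pow k n j : n + j < k -> image_length k n j = 2 ^ n.
Proof.
elim: n j => // n IH j hj; rewrite image_lengthS; last lia.
by rewrite -[size _]/(image_length k n 0) !IH ?expnS; lia.
Qed.

Lemma size_fin_kbonacci_pow k n : n < k -> size (fin_kbonacci k n) = 2 ^ n.
Proof. by move=> hn; rewrite -(image_length_pow k n 0) ?addn0. Qed.

(** Every application doubles the length until the last one, when exactly one digit has reached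
    [k - 1] and has an image of length one. *)
Lemma image_length_pow_pred k n j : 1 < k -> n.+1 + j = k ->
  (image_length k n.+1 j).+1 = 2 ^ n.+1.
Proof.
move=> hk; elim: n j => [|n IH] j hj.
  by rewrite (_ : j = k.-1) ?image_lengthS_large //; lia.
rewrite image_lengthS; last lia.
by rewrite -addnS IH ?size_fin_kbonacci_pow ?(expnS _ n.+1); lia.
Qed.

Lemma size_fin_kbonacci_eq k : 1 < k -> (size (fin_kbonacci k k)).+1 = 2 ^ k.
Proof.
by case: k => // k hk; rewrite -(image_length_pow_pred k.+1 k 0) ?addn0.
Qed.

Lemma image_length_sum k n j c : j + c < k -> c <= n ->
  image_length k n j = length_sum k n c + image_length k (n - c) (j + c).
Proof.
elim: c n j => [|c IH] [|n] j hj hn //; first by rewrite addn0.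
rewrite image_lengthS; last lia.
by rewrite (IH n j.+1) ?subSS ?addSnnS /= ?addnA //; lia.
Qed.

Lemma image_length_pred2 k q : 2 < k -> image_length k q.+2 (k - 2) =
  size (fin_kbonacci k q.+1) + size (fin_kbonacci k q).
Proof.
move=> hk; rewrite image_lengthS; last lia.
by rewrite (_ : (k - 2).+1 = k.-1) ?image_lengthS_large; lia.
Qed.

(** The [k]-bonacci recurrence; its last two terms stand apart because
    [length_sum k (k + q).+1 k.-1] omits them. *)
Lemma size_fin_kbonacci_sum k q : 2 < k -> size (fin_kbonacci k (k + q)) =
  length_sum k (k + q) (k - 2) +
  size (fin_kbonacci k q.+1) + size (fin_kbonacci k q).
Proof.
move=> hk; rewrite -[size _]/(image_length k (k + q) 0).
rewrite (image_length_sum k _ _ (k - 2)) ?add0n; [|lia..].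
by rewrite (_ : k + q - (k - 2) = q.+2) ?image_length_pred2 ?addnA; lia.
Qed.

(** The difference of two consecutive instances of the [k]-bonacci recurrence. *)
Lemma size_fin_kbonacci_rec k q : 2 < k ->
  size (fin_kbonacci k (k + q).+1) + size (fin_kbonacci k q) =
  2 * size (fin_kbonacci k (k + q)).
Proof.
move=> hk; have := size_fin_kbonacci_sum k q hk.
rewrite -[size (fin_kbonacci k (k + q).+1)]/(image_length k (k + q).+1 0).
rewrite image_lengthS; last lia.
rewrite (image_length_sum k (k + q) 1 (k - 2)); [|lia..].
have -> : k + q - (k - 2) = q.+2 by lia.
have -> : 1 + (k - 2) = k.-1 by lia.
rewrite image_lengthS_large; lia.
Qed.

Lemma length_sum_pow k n c : n <= c -> n <= k -> (length_sum k n c).+1 = 2 ^ n.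
Proof.
elim: n c => [|n IH] [|c] //= hc hn.
by rewrite -addnS IH ?size_fin_kbonacci_pow ?expnS; lia.
Qed.

(** Solves [w(k+q+1) = 2 w(k+q) - w(q)] in the range where [w(q) = 2 ^ q]. *)
Lemma size_fin_kbonacci_closed k q : 2 < k -> q <= k ->
  2 * size (fin_kbonacci k (k + q)) + q * 2 ^ q =
  2 * (size (fin_kbonacci k k) * 2 ^ q).
Proof.
move=> hk; elim: q => [_|q IH hq]; first by rewrite addn0; lia.
have := size_fin_kbonacci_rec k q hk; rewrite (size_fin_kbonacci_pow k q) //.
have := IH (ltnW hq); rewrite addnS expnS.
by move: (2 ^ q) (size _) (size _) (size _) => T a b c; lia.
Qed.

(* By [size_fin_kbonacci_sum], the slack in [length_sum_leqif] at [m = k + q]. *)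
Definition excess k q : int :=
  ((size (fin_kbonacci k k))%:Z *
     ((size (fin_kbonacci k q.+1))%:Z + (size (fin_kbonacci k q))%:Z)
   - 3 * (size (fin_kbonacci k (k + q)))%:Z)%R.

(** [excess] is a fixed linear combination of shifts of [w], so it inherits the recurrence of
    [w]. *)
Lemma excess_rec k q : 2 < k ->
  (excess k (k + q).+1 + excess k q = 2 * excess k (k + q))%R.
Proof.
move=> hk; rewrite /excess.
have := size_fin_kbonacci_rec k q hk.
have := size_fin_kbonacci_rec k q.+1 hk.
have := size_fin_kbonacci_rec k (k + q) hk.
rewrite !addnS.
move: (size _) (size (_ _ (k + q).+1)) (size (_ _ (k + (k + q))))
  (size (_ _ (k + q))) (size (_ _ (k + (k + q)).+1)) (size (_ _ (k + q).+2))
  (size (_ _ q.+1)) (size (_ _ q)) => D a b c d e f g E1 E2 E3.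
have -> : (d%:Z = 2 * b%:Z - c%:Z)%R by lia.
have -> : (e%:Z = 2 * a%:Z - f%:Z)%R by lia.
have -> : (g%:Z = 2 * c%:Z - a%:Z)%R by lia.
by ring.
Qed.

Lemma excess0 k : 2 < k -> excess k 0 = 0%R.
Proof.
move=> hk; rewrite /excess addn0 (size_fin_kbonacci_pow k 0); last lia.
by rewrite (size_fin_kbonacci_pow k 1) ?expn1 ?expn0; lia.
Qed.

Lemma excess_small k q : 2 < k -> q.+1 < k ->
  (2 * excess k q = 3 * (q * 2 ^ q)%:Z)%R.
Proof.
move=> hk hq; rewrite /excess (size_fin_kbonacci_pow k q); last lia.
rewrite (size_fin_kbonacci_pow k q.+1) ?expnS; last lia.
have := size_fin_kbonacci_closed k q hk (ltnW (ltnW hq)).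
move: (2 ^ q) (q * 2 ^ q) (size _) (size (_ _ (k + q))) => T u D w E.
have -> : (u%:Z = 2 * (D%:Z * T%:Z) - 2 * w%:Z)%R by lia.
by rewrite PoszM; ring.
Qed.

(** Below [k - 2] the closed form applies. From [k] on, the recurrence makes the increment equal to
    [excess k q - excess k (q - k)], nonnegative by induction. *)
Lemma excess_leS k q : 2 < k -> (excess k q <= excess k q.+1)%R.
Proof.
move=> hk; elim/ltn_ind: q => q IH.
have [hq|] := ltnP q (k - 2).
  have := excess_small k q.+1 hk; have := excess_small k q hk.
  by move=> E1 E2; have := leq0n (q * 2 ^ q); rewrite expnS mulSn in E2; lia.
have [hq|hq] := leqP k q => hq'.
  have := excess_rec k (q - k) hk; rewrite subnKC //.
  have : (excess k (q - k) <= excess k q)%R.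
    have : forall d, d <= k -> (excess k (q - k) <= excess k (q - k + d))%R.
      elim=> [|d IHd] hd; first by rewrite addn0.
      by apply: le_trans (IHd (ltnW hd)) _; rewrite addnS; apply: IH; lia.
    by move=> /(_ k (leqnn k)); rewrite subnK.
  by lia.
(* Only [q = k - 2] and [q = k - 1] remain. With [r = k - 2] the three values involved are affine in
   [2 ^ r] and [r * 2 ^ r], and [r >= 1] decides. *)
have [r Ek] : exists r, k = r.+2 by exists (k - 2); lia.
have ET : (size (fin_kbonacci k k)).+1 = 4 * 2 ^ r.
  by rewrite size_fin_kbonacci_eq ?Ek ?expnS; lia.
have hT : 2 ^ r <= r * 2 ^ r by rewrite leq_pmull; lia.
have x0 : (2 * excess k r = 3 * (r * 2 ^ r)%:Z)%R.
  by rewrite excess_small //; lia.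
have x1 : (2 * excess k r.+1 =
    6 * (r * 2 ^ r)%:Z + 6 * (2 ^ r)%:Z - 2 * (size (fin_kbonacci k k))%:Z)%R.
  rewrite /excess -Ek (size_fin_kbonacci_pow k r.+1) ?expnS; last lia.
  have h : r.+1 <= k by lia.
  have := size_fin_kbonacci_closed k r.+1 hk h; rewrite expnS (mulSn r) (mulnCA r).
  move: ET; move: (2 ^ r) (r * 2 ^ r) (size _) (size (_ _ (k + r.+1))) => T P D w.
  move=> ET E; have -> : (w%:Z = 2 * (D%:Z * T%:Z) - T%:Z - P%:Z)%R by lia.
  by have -> : (D%:Z = 4 * T%:Z - 1)%R; [lia | rewrite PoszM; ring].
have x2 : (2 * excess k k =
    12 * (r * 2 ^ r)%:Z + 24 * (2 ^ r)%:Z - 8 * (size (fin_kbonacci k k))%:Z)%R.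
  rewrite /excess.
  have := size_fin_kbonacci_rec k 0 hk; rewrite addn0 (size_fin_kbonacci_pow k 0); last lia.
  rewrite expn0.
  have := size_fin_kbonacci_closed k k hk (leqnn k).
  have -> : k * 2 ^ k = 4 * (r * 2 ^ r) + 8 * 2 ^ r by rewrite Ek !expnS; lia.
  have -> : 2 ^ k = 4 * 2 ^ r by rewrite Ek !expnS; lia.
  move: ET; move: (2 ^ r) (r * 2 ^ r) (size (_ _ k)) (size (_ _ k.+1))
    (size (_ _ (k + k))) => T P D u w ET E1 E2.
  have -> : (w%:Z = 4 * (D%:Z * T%:Z) - 2 * P%:Z - 4 * T%:Z)%R by lia.
  have -> : (u%:Z = 2 * D%:Z - 1)%R by lia.
  by have -> : (D%:Z = 4 * T%:Z - 1)%R; [lia | ring].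
have [->|->] : q = r \/ q = r.+1 by lia.
  by lia.
rewrite -Ek; lia.
Qed.

Lemma excess_gt0 k q : 2 < k -> 0 < q -> (0 < excess k q)%R.
Proof.
move=> hk; elim: q => // -[_ _|q IH _]; last first.
  by have := IH isT; have := excess_leS k q.+1 hk; lia.
by have := excess_small k 1 hk; lia.
Qed.

(** For [m >= k] the slack is [excess k (m - k)], zero only at [m = k]. For smaller [m] the terms of
    the sum are powers of two and the inequality is strict. *)
Lemma length_sum_leqif k m : 2 < k ->
  length_sum k m.+1 k.-1 * size (fin_kbonacci k k) + 3 * size (fin_kbonacci k m)
  <= 2 * (size (fin_kbonacci k k) * size (fin_kbonacci k m)) ?= iff (m == k).
Proof.
move=> hk; rewrite (_ : k.-1 = (k - 2).+1) /=; last lia.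
apply/leqifP; have D1 := size_fin_kbonacci_eq k (ltnW hk).
have [hm|hm] := ltnP m k.-1.
  have -> : m == k = false by lia.
  have h1 : m <= k - 2 by lia.
  have h2 : m < k by lia.
  have := length_sum_pow k m _ h1 (ltnW h2); rewrite (size_fin_kbonacci_pow k m) //.
  have : 4 * 2 ^ m <= 2 ^ k by rewrite -(expnD 2 2) leq_exp2l; lia.
  have : 2 ^ 3 <= 2 ^ k by rewrite leq_exp2l.
  have : 2 ^ m = 1 \/ 2 <= 2 ^ m.
    by case: (m) => [|n]; [left | right; rewrite -{1}(expn1 2) leq_exp2l].
  rewrite -D1; move: (2 ^ m) (size _) (length_sum _ _ _) => T D l h3 h4 h5 ET.
  by subst T; lia.
have [hm'|hm'] := ltnP m k.
  have -> : m == k = false by lia.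
  (* The [k - 2] terms now stop at [w(1)], leaving out [w(0)]. *)
  have Em : m = k.-1 by lia.
  have := image_length_sum k m 0 (k - 2).
  have h : 2 ^ 2 <= 2 ^ m by rewrite leq_exp2l; lia.
  have E2 : 2 ^ k = 2 * 2 ^ m by rewrite -expnS; congr (2 ^ _); lia.
  rewrite (_ : m - (k - 2) = 1) ?add0n; last lia.
  rewrite (image_length_pow k 1) -?[image_length k m 0]/(size (fin_kbonacci k m));
    last lia.
  move=> /(_ _ _); rewrite size_fin_kbonacci_pow // => E.
  have {}E : 2 ^ m = length_sum k m (k - 2) + 2 by rewrite E ?expn1; lia.
  by move: h D1 E; rewrite E2; move: (2 ^ m) (size _) (length_sum _ _ _); nia.
have h : ((excess k (m - k) == 0) = (m == k))%R.
  have [->|nm] := eqVneq m k; first by rewrite subnn excess0.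
  by have := excess_gt0 k (m - k) hk; lia.
have h' : (0 <= excess k (m - k))%R.
  have [->|nm] := eqVneq m k; first by rewrite subnn excess0.
  by have := excess_gt0 k (m - k) hk; lia.
have := size_fin_kbonacci_sum k (m - k) hk; move: h h'.
rewrite /excess subnKC //.
move: (size _) (size (_ _ m)) (size (_ _ (m - k).+1)) (size (_ _ (m - k)))
  (length_sum _ _ _) => D w a b l; case: (m == k); nia.
Qed.

(** * Bound on repetitions of a given period *)

Lemma size_fin_kbonacci_ge7 k : 2 < k -> 7 <= size (fin_kbonacci k k).
Proof.
move=> hk; rewrite -ltnS size_fin_kbonacci_eq; last lia.
by rewrite -[8]/(2 ^ 3) leq_exp2l.
Qed.

Lemma agree_leq k s p l : 2 < k -> 0 < p -> agree k s (s + p) l ->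
  l * size (fin_kbonacci k k) + 3 * p <= 2 * (size (fin_kbonacci k k) * p) /\
  (l * size (fin_kbonacci k k) + 3 * p = 2 * (size (fin_kbonacci k k) * p) ->
   exists i s', [/\ s = image_pos k k.+1 s', kbonacci k s' = k * i + k.-1
                  & p = size (fin_kbonacci k k)]).
Proof.
move=> hk p0 hl; have k1 : 1 < k by lia.
have st : s < s + p by lia.
have D7 := size_fin_kbonacci_ge7 k hk.
have [n [s' [t' [d [st' ne Es Et hd]]]]] := desubstitute k s (s + p) k1 st.
have [e [he hcase]] := agree_exactly_image_pos k n s' t' hk st' ne.
have hle : d + l <= e.
  by apply: (agree_exactly_max _ _ _ _ _ he); apply: agree_cat; rewrite // -Es -Et.
have hs : l <= p -> l * size (fin_kbonacci k k) + 3 * p <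
    2 * (size (fin_kbonacci k k) * p).
  by move: D7; move: (size _) => D; nia.
case: hcase => [hcase|[i [Et' Es' _ Ee]]].
  have /hs {}hs : l <= p by lia.
  by split; lia.
have Ep : p = image_length k n (kbonacci k s').
  by move: Et Es; rewrite Et' image_posS; lia.
case: n => [|m] in Es Et Ee Ep hd he *.
  have /hs {}hs : l <= p by move: Ee hle => /= ->; lia.
  by split; lia.
rewrite Es' image_length_shift image_lengthS_large // in Ep.
have [h1 h2] := length_sum_leqif k m hk.
rewrite Ep.
have h3 : l * size (fin_kbonacci k k) <=
    length_sum k m.+1 k.-1 * size (fin_kbonacci k k).
  by rewrite leq_mul2r; apply/orP; right; lia.
split; first lia.
move=> E; have Em : m = k by apply/eqP; rewrite -h2; lia.
subst m; exists i, s'; split=> //.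
(* Equality makes [l] the full common prefix, which forces the offset [d] to be zero. *)
have : l * size (fin_kbonacci k k) =
  length_sum k k.+1 k.-1 * size (fin_kbonacci k k) by lia.
by move/eqP; rewrite eqn_pmul2r; [move/eqP|]; lia.
Qed.

(** * The word [P_word] and its shifted occurrences *)

Lemma iter_phi_digit k n j c : j + c < k -> c <= n ->
  iter n (phi k) [:: j] =
  flatten [seq fin_kbonacci k m | m <- rev (iota (n - c) c)] ++
  iter (n - c) (phi k) [:: j + c].
Proof.
elim: c n j => [|c IH] [|n] j hj hn //; rewrite ?addn0 ?subn0 //.
have hj' : j < k.-1 by lia.
have := phi_small k 0 j hj'; rewrite muln0 => E.
rewrite iterSr [phi k _]E -cat1s iter_phi_cat (IH n j.+1); [|lia..].
rewrite subSS -[c.+1]addn1 iotaD rev_cat /= subnK; last lia.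
by rewrite addSnnS addn1 -catA.
Qed.

(** [W_k] is [W_(k-1) ... W_2] followed by the twofold image of [k - 2], of length three; so
    [P_word k] is three copies of [W_k] without the last three digits. *)
Lemma P_wordE k : 2 < k ->
  P_word k = mkseq (fun j => nth 0 (fin_kbonacci k k)
                               (j %% size (fin_kbonacci k k)))
                   (3 * size (fin_kbonacci k k) - 3).
Proof.
move=> hk; rewrite /P_word.
have D7 := size_fin_kbonacci_ge7 k hk.
set Q := flatten _; set W := fin_kbonacci k k in D7 *.
have [R EW sR] : exists2 R, W = Q ++ R & size R = 3.
  exists (iter 2 (phi k) [:: k - 2]).
    have -> : W = iter k (phi k) [:: 0] by [].
    rewrite (iter_phi_digit k k 0 (k - 2)) ?add0n; [|lia..].
    by rewrite (_ : k - (k - 2) = 2) //; lia.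
  rewrite -/(image_length k 2 (k - 2)) image_length_pred2 //.
  rewrite (size_fin_kbonacci_pow k 1) ?(size_fin_kbonacci_pow k 0) //; lia.
have sQ : size Q = size W - 3 by rewrite EW size_cat sR addnK.
apply: (@eq_from_nth _ 0); rewrite ?size_mkseq !size_cat sQ; first lia.
move=> j hj; rewrite nth_mkseq; last lia.
rewrite !nth_cat; case: ltnP => h1; first by rewrite modn_small.
have -> : j %% size W = (j - size W) %% size W.
  by rewrite -{1}(subnK h1) modnDr.
 case: ltnP => h2; first by rewrite modn_small.
have -> : (j - size W) %% size W = j - size W - size W.
  by rewrite -{1}(subnK h2) modnDr modn_small; lia.
have : j - size W - size W < size Q by rewrite sQ; lia.
by move: (_ - _ - _) => x hx; rewrite EW nth_cat hx.
Qed.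

Lemma agree_mod k s p l j : 0 < p -> agree k s (s + p) l -> j < p + l ->
  kbonacci k (s + j) = kbonacci k (s + j %% p).
Proof.
move=> p0 h; elim/ltn_ind: j => j IH hj.
have [hp|hp] := ltnP j p; first by rewrite modn_small.
have -> : j = p + (j - p) by lia.
rewrite modnDl addnA -h; last lia.
by apply: IH; lia.
Qed.

Lemma iter_phi_critical k i : 1 < k ->
  iter k.+1 (phi k) [:: k * i + k.-1] = shift_word (k * i.+1) (fin_kbonacci k k).
Proof. by move=> hk; rewrite iterSr phi_large // iter_phi_multiple. Qed.

Lemma kbonacci_critical k s i j : 1 < k -> kbonacci k s = k * i + k.-1 ->
  j < size (fin_kbonacci k k) ->
  kbonacci k (image_pos k k.+1 s + j) = k * i.+1 + nth 0 (fin_kbonacci k k) j.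
Proof.
move=> hk E hj; rewrite kbonacci_image_pos //; last first.
  by rewrite E /image_length iter_phi_critical // size_map.
by rewrite E iter_phi_critical // (nth_map 0).
Qed.

Lemma kbonacci_critical_slice k s i : 2 < k -> kbonacci k s = k * i + k.-1 ->
  agree k (image_pos k k.+1 s) (image_pos k k.+1 s + size (fin_kbonacci k k))
    (2 * size (fin_kbonacci k k) - 3) ->
  mkseq (fun j => kbonacci k (image_pos k k.+1 s + j))
    (3 * size (fin_kbonacci k k) - 3) = shift_word (k * i.+1) (P_word k).
Proof.
move=> hk E h; have D7 := size_fin_kbonacci_ge7 k hk.
rewrite P_wordE // /shift_word -map_comp; apply/eq_in_map => j.
rewrite mem_iota => hj /=; rewrite (agree_mod _ _ _ _ j _ h) //; [|lia..].
by rewrite (kbonacci_critical k s i) //; [lia | rewrite ltn_mod; lia].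
Qed.

(** The image of a digit ends in its successor, so every digit occurs. *)
Lemma kbonacci_digit k d : 1 < k -> exists x, kbonacci k x = d.
Proof.
move=> hk; elim: d => [|d [x E]]; first by exists 0.
have [i [j [Ed hj]]] := digitP k d (ltnW hk); rewrite {}Ed in E *.
have [hj'|hj'] := ltnP j k.-1.
  have [_ _ E'] := image_pos1_small k x i j hj' E.
  by exists (image_pos k 1 x).+1; rewrite E' addnS.
have Ej : j = k.-1 by lia.
rewrite Ej in E *; have [_ E'] := image_pos1_large k x i hk E.
by exists (image_pos k 1 x); rewrite E' -addnS prednK ?mulnSr; lia.
Qed.

(** For [j < k - 1], applying [phi] to the neighbours [k i + j], [k (i+1)] yields the neighbours
    [k i + j + 1], [k (i+1)]. *)
Lemma kbonacci_block_end k i : 2 < k ->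
  exists x, kbonacci k x = k * i + k.-1 /\ kbonacci k x.+1 = k * i.+1.
Proof.
move=> hk; have k1 : 1 < k by lia.
suff /(_ k.-1) [||x] : forall j, 0 < j -> j < k -> exists x,
    kbonacci k x = k * i + j /\ kbonacci k x.+1 = k * i.+1; [lia|lia|by exists x|].
elim=> // -[_ _ _|j IH _ hj].
  (* The pair with [j = 1]: two applications to [k i + k - 2] give [k i], [k i + 1], [k (i+1)]. *)
  have [y Ey] := kbonacci_digit k (k * i + (k - 2)) k1.
  have hj : k - 2 < k.-1 by lia.
  have [_ A1 A2] := image_pos1_small k y i (k - 2) hj Ey.
  rewrite (_ : (k - 2).+1 = k.-1) in A2; last lia.
  rewrite -(addn0 (k * i)) in A1.
  have hk0 : 0 < k.-1 by lia.
  have [B0 _ B2] := image_pos1_small k _ i 0 hk0 A1.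
  have [_ C2] := image_pos1_large k _ i k1 A2.
  by exists (image_pos k 1 (image_pos k 1 y)).+1; rewrite -B0.
have [|x [E1 E2]] := IH isT; first lia.
have hj' : j.+1 < k.-1 by lia.
have [B0 _ B2] := image_pos1_small k x i j.+1 hj' E1.
exists (image_pos k 1 x).+1; rewrite -B0; split=> //.
by rewrite kbonacci_image_pos1 // E2 -{1}(addn0 (k * i.+1)) succ_div //; lia.
Qed.

(** The length [2 w(k) - 3] is the value of the sum in the equality case [m = k] of
    [length_sum_leqif]. *)
Lemma agree_critical k s i : 2 < k ->
  kbonacci k s = k * i + k.-1 -> kbonacci k s.+1 = k * i.+1 ->
  agree k (image_pos k k.+1 s) (image_pos k k.+1 s + size (fin_kbonacci k k))
    (2 * size (fin_kbonacci k k) - 3).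
Proof.
move=> hk E1 E2; have D7 := size_fin_kbonacci_ge7 k hk.
have hk0 : 0 < k.-1 by lia.
have E2' : kbonacci k s.+1 = k * i.+1 + 0 by rewrite addn0.
have [d [[hd _] _ hdE]] := agree_exactly_next_block k k.+1 s s.+1 i 0 hk hk0 E1 E2'.
have [_ h] := length_sum_leqif k k hk.
have Ed : d = 2 * size (fin_kbonacci k k) - 3.
  rewrite hdE // subn0; move/eqP: h; rewrite eqxx.
  by move: D7; move: (size _) (length_sum _ _ _) => D l; nia.
rewrite -Ed; move: hd; rewrite image_posS E1 image_length_shift.
by rewrite image_lengthS_large //; lia.
Qed.

Lemma size_P_word k : 2 < k -> size (P_word k) = 3 * size (fin_kbonacci k k) - 3.
Proof. by move=> hk; rewrite P_wordE // size_mkseq. Qed.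

Lemma factor_shift_P_word k i : 2 < k ->
  factor (kbonacci k) (shift_word (k * i.+1) (P_word k)).
Proof.
move=> hk; have [s [E1 E2]] := kbonacci_block_end k i hk.
exists (image_pos k k.+1 s); rewrite size_map size_P_word //.
by rewrite (kbonacci_critical_slice k s i) //; apply: (agree_critical k s i).
Qed.

(** * From repetitions to rational exponents and critical powers *)

Definition periodic_word (U : seq nat) n :=
  mkseq (fun j => nth 0 U (j %% size U)) n.

(** A power of length [n > |U|] is an agreement over [n - |U|] digits at distance [|U|]; the extra
    period turns the [2] of [agree_leq] into [3]. Shorter powers stay strictly below the bound. *)
Lemma periodic_factor k U n : 2 < k -> U != [::] ->
  factor (kbonacci k) (periodic_word U n) ->
  n * size (fin_kbonacci k k) + 3 * size U <= 3 * (size (fin_kbonacci k k) * size U)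
  /\ (n * size (fin_kbonacci k k) + 3 * size U =
        3 * (size (fin_kbonacci k k) * size U) ->
      exists i, periodic_word U n = shift_word (k * i.+1) (P_word k)).
Proof.
move=> hk U0 [q]; rewrite size_mkseq => Eq.
have p0 : 0 < size U by case: U U0 {Eq}.
have D7 := size_fin_kbonacci_ge7 k hk.
have [hn|hn] := leqP n (size U).
  suff : n * size (fin_kbonacci k k) + 3 * size U <
      3 * (size (fin_kbonacci k k) * size U) by lia.
  by move: p0 D7 hn; move: (size _) (size _); nia.
have EW j : j < n -> kbonacci k (q + j) = nth 0 U (j %% size U).
  by move=> hj; move: (congr1 (nth 0 ^~ j) Eq); rewrite !nth_mkseq.
have h : agree k q (q + size U) (n - size U).
  by move=> j hj; rewrite -addnA !EW ?modnDl //; lia.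
have [h1 h2] := agree_leq k q (size U) (n - size U) hk p0 h.
have En : n = size U + (n - size U) by lia.
split; first by rewrite En mulnDl; lia.
move=> E; have {h2} [|i [s [Es Ei Ep]]] := h2.
  by move: E; rewrite {1}En mulnDl; lia.
exists i; have E3 : n = 3 * size (fin_kbonacci k k) - 3.
  by move: E D7; rewrite Ep; move: (size _) => D; nia.
have E4 : 2 * size (fin_kbonacci k k) - 3 = n - size U by lia.
by rewrite Eq E3 Es; apply: kbonacci_critical_slice; rewrite // E4 -Es -Ep.
Qed.

Local Open Scope ring_scope.
Local Open Scope classical_set_scope.

(** Since [w(k) = 2 ^ k - 1], multiplying by [p * w(k)] clears all denominators. *)
Lemma exponent_leq k n p : (2 < k)%N -> (0 < p)%N ->
  (n%:R / p%:R <= 3 - 3 / (2 ^+ k - 1) :> rat) =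
  (n * size (fin_kbonacci k k) + 3 * p <= 3 * (size (fin_kbonacci k k) * p))%N /\
  (n%:R / p%:R == 3 - 3 / (2 ^+ k - 1) :> rat) =
  (n * size (fin_kbonacci k k) + 3 * p == 3 * (size (fin_kbonacci k k) * p))%N.
Proof.
move=> hk p0; have D7 := size_fin_kbonacci_ge7 k hk.
have -> : 2 ^+ k - 1 = (size (fin_kbonacci k k))%:R :> rat.
  by rewrite -natrX -size_fin_kbonacci_eq ?(ltnW hk) // -natr1 addrK.
move: (size _) D7 => D D7.
have pD0 : 0 < p%:R * D%:R :> rat by rewrite mulr_gt0 ?ltr0n //; lia.
have p1 : p%:R != 0 :> rat by rewrite pnatr_eq0; lia.
have D1 : D%:R != 0 :> rat by rewrite pnatr_eq0; lia.
have E1 : n%:R / p%:R * (p%:R * D%:R) = (n * D)%:R :> rat.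
  by rewrite natrM; field.
have E2 : (3 - 3 / D%:R) * (p%:R * D%:R) = (3 * (D * p))%:R - (3 * p)%:R :> rat.
  by rewrite !natrM; field.
split.
  by rewrite -(ler_pM2r pD0) E1 E2 lerBrDr -natrD ler_nat.
rewrite -(inj_eq (mulIf (lt0r_neq0 pD0))) E1 E2.
by rewrite eq_sym subr_eq eq_sym -natrD eqr_nat.
Qed.

Lemma is_powerP U r V : U != [::] -> is_power U r V <->
  r = (size V)%:R / (size U)%:R /\ V = periodic_word U (size V).
Proof.
move=> U0; have p1 : (size U)%:R != 0 :> rat by rewrite pnatr_eq0 size_eq0.
rewrite /is_power /periodic_word; split=> -[h1 h2]; split=> //.
  by rewrite h1 mulfK.
by rewrite h1 divfK.
Qed.

Lemma power_leq k U r V : (2 < k)%N -> U != [::] ->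
  is_power U r V -> factor (kbonacci k) V ->
  r <= 3 - 3 / (2 ^+ k - 1) /\
  (r = 3 - 3 / (2 ^+ k - 1) ->
   exists i, V = shift_word (k * i.+1)%N (P_word k)).
Proof.
move=> hk U0 /(is_powerP _ _ _ U0)[-> EV]; rewrite EV => hf.
have p0 : (0 < size U)%N by rewrite lt0n size_eq0.
have [h1 h2] := periodic_factor k U _ hk U0 hf.
have [E1 E2] := exponent_leq k (size V) (size U) hk p0.
rewrite size_mkseq E1; split=> // /eqP; rewrite E2 => /eqP; exact: h2.
Qed.

(** The exponents are [n / |U|] for the lengths [n] of powers of [U] in the word; these are at most
    [3 |U|], so a largest one is attained. *)
Lemma index_exists k U : (2 < k)%N -> nonempty_factors (kbonacci k) U ->
  exists r, is_index (kbonacci k) U r.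
Proof.
move=> hk [U0 hU].
pose P n := `[< factor (kbonacci k) (periodic_word U n) >].
have D7 := size_fin_kbonacci_ge7 k hk.
have exP : exists n, P n.
  exists (size U); apply/asboolP; rewrite (_ : periodic_word _ _ = U) //.
  apply: (@eq_from_nth _ 0%N); rewrite size_mkseq // => j hj.
  by rewrite nth_mkseq // modn_small.
have bP n : P n -> (n <= 3 * size U)%N.
  move/asboolP => /(periodic_factor k U n hk U0)[h _].
  by move: h D7; move: (size (fin_kbonacci k k)) (size U); nia.
case: (ex_maxnP exP bP) => n /asboolP Pn maxn.
exists (n%:R / (size U)%:R); split.
  exists (periodic_word U n) => //; apply/is_powerP => //.
  by rewrite size_mkseq.
move=> r [V /(is_powerP _ _ _ U0)[-> EV] hV].
rewrite ler_pM2r ?invr_gt0 ?ltr0n ?lt0n ?size_eq0 // ler_nat.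
by apply: maxn; apply/asboolP; rewrite -EV.
Qed.

(** The base is [W_k] shifted by [k * i.+1]; its power of length [3 w(k) - 3] attains the bound of
    [power_leq]. *)
Lemma critical_power k i : (2 < k)%N ->
  exists2 U, is_power U (3 - 3 / (2 ^+ k - 1)) (shift_word (k * i.+1)%N (P_word k)) &
  nonempty_factors (kbonacci k) U /\
  is_index (kbonacci k) U (3 - 3 / (2 ^+ k - 1)).
Proof.
move=> hk; have k1 : (1 < k)%N by lia.
have D7 := size_fin_kbonacci_ge7 k hk.
pose U := shift_word (k * i.+1)%N (fin_kbonacci k k).
have sU : size U = size (fin_kbonacci k k) by rewrite size_map.
have U0 : U != [::] by rewrite -size_eq0 sU; lia.
have hp : is_power U (3 - 3 / (2 ^+ k - 1)) (shift_word (k * i.+1)%N (P_word k)).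
  apply/is_powerP => //; rewrite size_map size_P_word // sU; split.
    have D0 : (0 < size (fin_kbonacci k k))%N by lia.
    apply/esym/eqP; have [_ ->] := exponent_leq k
      (3 * size (fin_kbonacci k k) - 3) (size (fin_kbonacci k k)) hk D0.
    by apply/eqP; move: D7; move: (size _); nia.
  rewrite P_wordE // /periodic_word /shift_word -map_comp; apply/eq_in_map => j _ /=.
  by rewrite sU (nth_map 0%N) // ltn_mod; lia.
have hf := factor_shift_P_word k i hk.
exists U => //; split.
  split=> //; have [s [E1 E2]] := kbonacci_block_end k i hk.
  exists (image_pos k k.+1 s); apply: (@eq_from_nth _ 0%N); rewrite ?size_mkseq //.
  move=> j hj; rewrite nth_mkseq // (kbonacci_critical k s i) // -?sU //.
  by rewrite (nth_map 0%N) // -sU.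
split; first by exists (shift_word (k * i.+1)%N (P_word k)).
by move=> r [V hV hV']; have [] := power_leq k U r V hk U0 hV hV'.
Qed.

Lemma kbonacci_critical_exponent k : (2 < k)%N ->
  is_critical_exponent (kbonacci k) (3 - 3 / (2 ^+ k - 1)).
Proof.
move=> hk; split=> [U|]; first exact: index_exists.
split=> [r [U [U0 _] [[V hV hV'] _]]|b hb].
  by have [] := power_leq k U r V hk U0 hV hV'.
by have [U _ [hU hI]] := critical_power k 0 hk; apply: hb; exists U.
Qed.

Lemma is_critical_exponent_uniq W e e' :
  is_critical_exponent W e -> is_critical_exponent W e' -> e = e'.
Proof.
by move=> [_ [h1 h2]] [_ [h1' h2']]; apply/le_anti; rewrite h2 ?h2'.
Qed.

Theorem theorem43 (k : nat) (hk : (3 <= k)%N) :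
  is_critical_exponent (kbonacci k) (3 - 3 / (2 ^+ k - 1)) /\
  critical_powers (kbonacci k) =
    [set shift_word (k * i)%N (P_word k) | i in [set i : nat | (1 <= i)%N]].
Proof.
have hE := kbonacci_critical_exponent k hk; split=> //.
apply/seteqP; split=> V.
  case=> U [e [[[U0 _] [e' he' [[V' hV' hf] _]]] he hV]].
  have Ee := is_critical_exponent_uniq _ _ _ he hE.
  have Ee' := is_critical_exponent_uniq _ _ _ he' hE.
  (* Both are powers of [U] with the same exponent, hence of the same length; so [V] itself is a
     factor. *)
  have EV : V = V'.
    case: hV hV' => [s1 ->] [s2 ->]; congr mkseq.
    by apply/eqP; rewrite -(eqr_nat rat) s1 s2 Ee Ee'.
  have [_ /(_ Ee)[i ->]] := power_leq k U e V hk U0 hV (eq_ind_r _ hf EV).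
  by exists i.+1.
case=> -[//|i] _ <-; have [U hU [hU1 hU2]] := critical_power k i hk.
exists U, (3 - 3 / (2 ^+ k - 1)); split=> //; split=> //.
by exists (3 - 3 / (2 ^+ k - 1)).
Qed.
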